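(* Let $(R,m_R)$ be a local ring with residue field $k$ of characteristic $p>0$, and let $q=p^r$ with $r\ge 1$. Assume that $pR\ne 0$, $pm_R=0$ and $m_R^{e+1}=0$ for some $1\le e\le q-1$. Let $i_1,\dots,i_n$ be positive integers with $i_j\le q$ for all $j$. Let $I\subset k[x_1,\dots,x_n]$ be an ideal and let $f_0\in I$ be a polynomial such that for each multiindex $(l_1,\dots,l_n)$ of a monomial occurring in $f_0$ we have $$\left\lfloor \frac{ql_1}{i_1}\right\rfloor+\dots+\left\lfloor \frac{ql_n}{i_n}\right\rfloor\ge e+1.$$ Set $A_0=k[x_1,\dots,x_n]/((x_1^{i_1},\dots,x_n^{i_n})+I)$. If $A_0$ is liftable to the canonical projection $R\to k=R/m_R$, then $$w_p\bigl(f_0^{p^{r-1}}\bigr)\in (x_1^{i_1},\dots,x_n^{i_n})+I.$$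
   Context: For a polynomial $f=\sum_{i=1}^m a_i x^{J_i}\in T[x_1,\dots,x_n]$ written as a sum of distinct monomials ($J_i$ multi-indices), over a ring $T$ in which $(p-1)!$ is invertible, define $$w_p(f):=\sum_{\substack{l_1+\dots+l_m=p\\ 0\le l_j<p}}\frac{1}{l_1!\cdots l_m!}(a_1x^{J_1})^{l_1}\cdots(a_mx^{J_m})^{l_m}.$$ A $k$-algebra $A_0$ is liftable to a surjection $R\to k$ if for $X=\operatorname{Spec} A_0$ there exist a flat $R$-scheme $\tilde X$ and a closed embedding $X\hookrightarrow\tilde X$ inducing an isomorphism $X\to\tilde X\times_{\operatorname{Spec} R}\operatorname{Spec} k$. *)

(* Defs.v *)
From HB Require Import structures.
From mathcomp Require Import all_boot all_order all_algebra.
From mathcomp Require Import boolp classical_sets topology_structure.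
From mathcomp Require Import mpoly.

Set Implicit Arguments.
Unset Strict Implicit.
Unset Printing Implicit Defensive.

Import GRing.Theory.

Local Open Scope classical_set_scope.
Local Open Scope ring_scope.

(* comPzRingType, because rings of sections and the quotients k[x]/J may be
   zero. *)

Definition is_ideal (A : comPzRingType) (I : set A) : Prop :=
  [/\ I 0, forall x y, I x -> I y -> I (x + y) & forall a x, I x -> I (a * x)].

Definition is_prime_ideal (A : comPzRingType) (P : set A) : Prop :=
  [/\ is_ideal P, ~ P 1 & forall x y, P (x * y) -> P x \/ P y].

Definition ideal_gen (A : comPzRingType) (S : set A) : set A :=
  smallest (@is_ideal A) S.

Definition ideal_add (A : comPzRingType) (I J : set A) : set A :=
  [set x + y | x in I & y in J].

Definition ideal_pow (A : comPzRingType) (I : set A) (n : nat) : set A :=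
  ideal_gen [set \prod_(j < n) x j | x in [set x : 'I_n -> A | forall j, I (x j)]].

Definition nonunits (R : comUnitRingType) : set R :=
  [set x | x \isn't a GRing.unit].

(* For a local ring, nonunits R is the maximal ideal m_R. *)
Definition is_local_ring (R : comUnitRingType) : Prop := is_ideal (@nonunits R).

(* pi is, up to a unique isomorphism of its target, the projection A -> A / I. *)
Definition is_quotient_map (A B : comPzRingType) (I : set A)
    (pi : {rmorphism A -> B}) : Prop :=
  (forall b, exists a, pi a = b) /\ (forall a, pi a = 0 <-> I a).

(* B is A[1/s], by way of phi. *)
Definition is_localization (A B : comPzRingType) (s : A)
    (phi : {rmorphism A -> B}) : Prop :=
  [/\ exists u, phi s * u = 1,
      forall b, exists a n, b * phi s ^+ n = phi a
    & forall a, phi a = 0 -> exists n, s ^+ n * a = 0].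

(* The tensor product of the R-modules M and N is the quotient of the free
   monoid seq (M * N), the sequence [:: (m_1, n_1); ...; (m_r, n_r)] standing
   for m_1 (x) n_1 + ... + m_r (x) n_r, by the following congruence.
   The scalar actions are explicit, since M and N may be rings that are
   R-modules through a ring morphism. *)
Inductive tensor_eq (R : Type) (M N : zmodType)
    (actM : R -> M -> M) (actN : R -> N -> N) :
    seq (M * N) -> seq (M * N) -> Prop :=
| tensor_refl s : tensor_eq actM actN s s
| tensor_sym s t : tensor_eq actM actN s t -> tensor_eq actM actN t s
| tensor_trans s t u :
    tensor_eq actM actN s t -> tensor_eq actM actN t u -> tensor_eq actM actN s u
| tensor_cat s s' t t' :
    tensor_eq actM actN s s' -> tensor_eq actM actN t t' ->
    tensor_eq actM actN (s ++ t) (s' ++ t')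
| tensor_comm s t : tensor_eq actM actN (s ++ t) (t ++ s)
| tensor_0l n : tensor_eq actM actN [:: (0, n)] [::]
| tensor_addl m m' n :
    tensor_eq actM actN [:: (m + m', n)] [:: (m, n); (m', n)]
| tensor_addr m n n' :
    tensor_eq actM actN [:: (m, n + n')] [:: (m, n); (m, n')]
| tensor_scale a m n :
    tensor_eq actM actN [:: (actM a m, n)] [:: (m, actN a n)].

(* N (x)_R B -> N' (x)_R B is injective for every injective linear N -> N'. *)
Definition flat_morphism (R : comNzRingType) (B : comPzRingType)
    (phi : {rmorphism R -> B}) : Prop :=
  forall (N N' : lmodType R) (h : {linear N -> N'}), injective h ->
  forall s : seq (N * B),
    tensor_eq *:%R (fun a b => phi a * b) [seq (h x.1, x.2) | x <- s] [::] ->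
    tensor_eq *:%R (fun a b => phi a * b) s [::].

Record opens (X : topologicalType) := Opens {
  opens_set :> set X;
  opens_open : open opens_set
}.

Record ringed_space := RingedSpace {
  carrier :> topologicalType;
  sections : opens carrier -> comPzRingType;
  res : forall U V : opens carrier,
    V `<=` U -> {rmorphism sections U -> sections V};
  res_id : forall (U : opens carrier) (sUU : U `<=` U) (s : sections U),
    res sUU s = s;
  res_comp : forall (U V W : opens carrier)
    (sVU : V `<=` U) (sWV : W `<=` V) (sWU : W `<=` U) (s : sections U),
    res sWV (res sVU s) = res sWU s;
  sheaf_locality : forall (U : opens carrier) (I : Type)
    (V : I -> opens carrier) (sVU : forall i, V i `<=` U),
    U `<=` \bigcup_i V i ->
    forall s t : sections U,
    (forall i, res (sVU i) s = res (sVU i) t) -> s = t;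
  sheaf_gluing : forall (U : opens carrier) (I : Type)
    (V : I -> opens carrier) (sVU : forall i, V i `<=` U),
    U `<=` \bigcup_i V i ->
    forall s : (forall i, sections (V i)),
    (forall i j (W : opens carrier) (sWi : W `<=` V i) (sWj : W `<=` V j),
       res sWi (s i) = res sWj (s j)) ->
    exists t : sections U, forall i, res (sVU i) t = s i
}.

Definition opensT (X : topologicalType) : opens X := Opens (@openT X).

Definition resT (X : ringed_space) (V : opens X) :
  {rmorphism sections (opensT X) -> sections V} :=
  @res X (opensT X) V (@subsetT _ V).

(* The germ of s at x is a unit. *)
Definition unit_at (X : ringed_space) (U : opens X) (s : sections U) (x : X) :
    Prop :=
  exists (V : opens X) (sVU : V `<=` U), opens_set V x /\ exists t, res sVU s * t = 1.

Lemma unit_at_open (X : ringed_space) (U : opens X) (s : sections U) :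
  open (unit_at s).
Proof.
rewrite openE => x [V [sVU [Vx st1]]].
rewrite /interior nbhsE /=; exists V; first by split=> //; exact: opens_open.
by move=> y Vy; exists V, sVU.
Qed.

Definition basic_open (X : ringed_space) (U : opens X) (s : sections U) :
  opens X := Opens (unit_at_open s).

Lemma basic_open_sub (X : ringed_space) (U : opens X) (s : sections U) :
  basic_open s `<=` U.
Proof. by move=> x [V [sVU [Vx _]]]; exact: sVU. Qed.

(* The canonical map from (U, O_X|U) to Spec O_X(U), which sends x to the ideal
   of the sections whose germ at x is not a unit, is well defined, bijective and
   a homeomorphism, and O_X(U)[1/s] -> O_X(D(s)) is an isomorphism for all s:
   so (U, O_X|U) is isomorphic to the spectrum of O_X(U). *)
Record is_affine_open (X : ringed_space) (U : opens X) : Prop := IsAffineOpen {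
  affine_prime : forall x, opens_set U x ->
    is_prime_ideal [set s : sections U | ~ unit_at s x];
  affine_point : forall P : set (sections U), is_prime_ideal P ->
    exists! x, opens_set U x /\ P = [set s : sections U | ~ unit_at s x];
  affine_basis : forall V : opens X, V `<=` U -> forall x, opens_set V x ->
    exists s : sections U, unit_at s x /\ basic_open s `<=` V;
  affine_localization : forall s : sections U,
    is_localization s (res (@basic_open_sub X U s))
}.

Definition is_scheme (X : ringed_space) : Prop :=
  forall x : X, exists U : opens X, opens_set U x /\ is_affine_open U.

(* X is Spec A, with gamma the identification of A with the global sections. *)
Definition is_spec (A : comPzRingType) (X : ringed_space)
    (gamma : {rmorphism A -> sections (opensT X)}) : Prop :=
  is_affine_open (opensT X) /\ bijective gamma.

Lemma opens_preim_open (X Y : topologicalType) (f : X -> Y)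
  (cf : continuous f) (V : opens Y) :
  open (f @^-1` V).
Proof. by move/continuousP: cf; apply; exact: opens_open. Qed.

Definition opens_preim (X Y : topologicalType) (f : X -> Y)
  (cf : continuous f) (V : opens Y) :
  opens X := Opens (opens_preim_open cf V).

(* Morphisms of locally ringed spaces: comor_local says that the induced maps of
   stalks are local. *)
Record scheme_morphism (X Y : ringed_space) := SchemeMorphism {
  mor_fun :> X -> Y;
  mor_cont : continuous mor_fun;
  comor : forall V : opens Y,
    {rmorphism sections V -> sections (opens_preim mor_cont V)};
  comor_nat : forall (V W : opens Y) (sWV : W `<=` V)
    (sWV' : opens_preim mor_cont W `<=` opens_preim mor_cont V)
    (s : sections V),
    comor W (res sWV s) = res sWV' (comor V s);
  comor_local : forall (V : opens Y) (s : sections V) (x : X),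
    opens_set V (mor_fun x) -> unit_at (comor V s) x -> unit_at s (mor_fun x)
}.

Definition preim (X Y : ringed_space) (f : scheme_morphism X Y) (V : opens Y) :
  opens X := opens_preim (@mor_cont X Y f) V.

(* A homeomorphism onto a closed subset such that O_Y -> f_* O_X is
   surjective. *)
Definition is_closed_embedding (X Y : ringed_space) (f : scheme_morphism X Y) :
    Prop :=
  [/\ injective f,
      forall U : opens X, exists V : opens Y, (U : set X) = f @^-1` V,
      closed (range f)
    & forall (V : opens Y) (s : sections (preim f V)) (y : Y), opens_set V y ->
      exists (W : opens Y) (sW : preim f W `<=` preim f V) (t : sections W),
        [/\ opens_set W y, W `<=` V & comor f W t = res sW s]].

(* Schemes over Spec R: the morphism X -> Spec R is given by the ring morphism
   sigma from R to the global sections of X. *)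

Definition is_flat_scheme (R : comNzRingType) (X : ringed_space)
    (sigma : {rmorphism R -> sections (opensT X)}) : Prop :=
  forall V : opens X, is_affine_open V ->
  flat_morphism (resT V \o sigma).

(* The square
        X   --- f --->  Y
        |               |
     Spec k  ------> Spec R
   commutes, and X -> Y x_(Spec R) Spec k is an isomorphism.  The fibre product
   is glued from the spectra of the O_Y(V) (x)_R k, V ranging over the affine
   open subsets of Y, the spectrum of O_Y(V) (x)_R k being the inverse image of
   V; so the latter says that the inverse images f^-1(V) are affine and that
   O_Y(V) (x)_R k -> O_X(f^-1(V)), b (x) c |-> f^#(b) c, is bijective. *)
Definition is_base_change (R k : comNzRingType) (pi : {rmorphism R -> k})
    (X Y : ringed_space) (f : scheme_morphism X Y)
    (kappa : {rmorphism k -> sections (opensT X)})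
    (sigma : {rmorphism R -> sections (opensT Y)}) : Prop :=
  (forall (V : opens Y) (a : R),
     comor f V (resT V (sigma a)) = resT (preim f V) (kappa (pi a))) /\
  (forall V : opens Y, is_affine_open V ->
     let phi (s : seq (sections V * k)) : sections (preim f V) :=
       \sum_(x <- s) comor f V x.1 * resT (preim f V) (kappa x.2) in
     [/\ is_affine_open (preim f V),
         forall t, exists s, phi s = t
       & forall s, phi s = 0 ->
         tensor_eq (fun a b => resT V (sigma a) * b) (fun a c => pi a * c)
           s [::]]).

(* A0 is the k-algebra with structure morphism kappa; X is Spec A0. *)
Definition liftable (R k : comNzRingType) (pi : {rmorphism R -> k})
    (A0 : comPzRingType) (kappa : {rmorphism k -> A0}) : Prop :=
  exists (X Y : ringed_space)
    (gamma : {rmorphism A0 -> sections (opensT X)})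
    (sigma : {rmorphism R -> sections (opensT Y)})
    (f : scheme_morphism X Y),
  [/\ is_spec gamma,
      is_scheme Y,
      is_flat_scheme sigma,
      is_closed_embedding f
    & is_base_change pi f (gamma \o kappa) sigma].

(* f = \sum_(j < m) a_j x^{J_j}, J_j being the j-th element of msupp f.
   Meaningful if (p-1)! is a unit of T. *)
Definition w_ (T : comUnitRingType) (n p : nat) (f : {mpoly T[n]}) :
    {mpoly T[n]} :=
  let m := size (msupp f) in
  let J (j : 'I_m) := nth 0%MM (msupp f) j in
  \sum_(l : {ffun 'I_m -> 'I_p} | (\sum_(j < m) l j)%N == p)
    ((\prod_(j < m) (l j)`!)%N%:R^-1 : T) *:
      \prod_(j < m) (f@_(J j) *: 'X_[J j]) ^+ l j.

(* Main.v *)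
Require Import Defs.
From HB Require Import structures.
From mathcomp Require Import all_boot all_order all_algebra.
From mathcomp Require Import boolp classical_sets topology_structure.
From mathcomp Require Import mpoly.
From mathcomp Require Import ring.

(** The obstruction is a computation in a deformation of A0.  If A0 is not zero,
    it is k plus nilpotents, so that its spectrum is one point, and any affine open neighbourhood of
    its image in the lift yields a flat R-algebra B and a surjection
    psi : B -> A0 with kernel m_R B ([liftable_local], [tensor_residue]).
    Flatness enters only through the annihilator of p: as p m_R = 0 and p <> 0,
    multiplication by p embeds k into R, hence A0 into B, so that p b = 0 forces
    psi b = 0 ([flat_annihilator]).

    Let P = p^(r-1), lift the variables to y_j in B and the coefficients of f0 to
    R, and let t_m be the resulting lifts to B of the monomials (with their
    coefficients) of f0.  Two p-th powers vanish.
    - The sum F of the t_m lies in m_R B because f0 is in I, so F^q lies in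
      m_R^(e+1) B = 0.  By the Frobenius congruence ([expr_sum_primeX]) the sum
      of the t_m^P differs from F^P by a multiple of p, and p^2 = 0 makes the
      p-th power blind to that difference; so (\sum t_m^P)^p = F^q = 0.
    - Each y_j^(i_j) is in m_R B, so t_m^q lies in the power of m_R B whose
      exponent is the sum of the floors of q m_j / i_j, and this is 0 too.
    The t_m^P lift the monomials of f0^P.  The multinomial formula
    ([multinomial_prime]) now gives
      p! W = (\sum t_m^P)^p - \sum t_m^q = 0
    where W lifts w_p (f0^P).  As (p-1)! is a unit, p W = 0, hence the image of
    w_p (f0^P) in A0 vanishes ([w_lift_eq0]). *)

Set Implicit Arguments.
Unset Strict Implicit.
Unset Printing Implicit Defensive.

Import GRing.Theory.

Local Open Scope classical_set_scope.
Local Open Scope ring_scope.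

(** * Ideals *)

Lemma ideal_gen_ideal (A : comPzRingType) (S : set A) : is_ideal (ideal_gen S).
Proof.
split=> [M [[M0 _ _] _] | x y Sx Sy M MS | a x Sx M MS]; first exact: M0.
- by have [[_ MD _] _] := MS; apply: MD; [apply: Sx | apply: Sy].
- by have [[_ _ MM] _] := MS; apply: MM; apply: Sx.
Qed.

Lemma mem_ideal_gen (A : comPzRingType) (S : set A) x : S x -> ideal_gen S x.
Proof. by move=> Sx M [_]; apply. Qed.

Lemma ideal_gen_min (A : comPzRingType) (S M : set A) :
  is_ideal M -> S `<=` M -> ideal_gen S `<=` M.
Proof. by move=> idM SM x; apply. Qed.

Lemma ideal_sub (A : comPzRingType) (I : set A) x y :
  is_ideal I -> I x -> I y -> I (x - y).
Proof. by move=> [_ ID IM] Ix Iy; apply: ID => //; rewrite -mulN1r; apply: IM. Qed.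

Lemma ideal_sum (A : comPzRingType) (I : set A) (T : Type) (s : seq T)
    (P : pred T) (F : T -> A) :
  is_ideal I -> (forall i, P i -> I (F i)) -> I (\sum_(i <- s | P i) F i).
Proof. by move=> [I0 ID _] IF; elim/big_ind: _. Qed.

(** A product is linear in each factor, so an inclusion of products of ideals
    needs checking on generators only. *)
Lemma ideal_genM (A : comPzRingType) (S T U : set A) x y :
  is_ideal U -> (forall s t, S s -> T t -> U (s * t)) ->
  ideal_gen S x -> ideal_gen T y -> U (x * y).
Proof.
move=> [U0 UD UM] STU Sx; apply: (@ideal_gen_min _ T (fun y => U (x * y))).
  split=> [|a b Ua Ub|a b Ub]; first by rewrite mulr0.
    by rewrite mulrDr; apply: UD.
  by rewrite mulrCA; apply: UM.
move=> t Tt; apply: (@ideal_gen_min _ S (fun x => U (x * t))) x Sx.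
  split=> [|a b Ua Ub|a b Ub]; first by rewrite mul0r.
    by rewrite mulrDl; apply: UD.
  by rewrite -mulrA; apply: UM.
by move=> s Ss; apply: STU.
Qed.

Lemma ideal_pow_prod (A : comPzRingType) (I : set A) t (x : 'I_t -> A) :
  (forall j, I (x j)) -> ideal_pow I t (\prod_j x j).
Proof. by move=> Ix; apply: mem_ideal_gen; exists x. Qed.

Lemma ideal_powM (A : comPzRingType) (I : set A) s t x y :
  ideal_pow I s x -> ideal_pow I t y -> ideal_pow I (s + t) (x * y).
Proof.
apply: ideal_genM; first exact: ideal_gen_ideal.
move=> _ _ [a Ia <-] [b Ib <-].
pose c (j : 'I_(s + t)) := match split j with inl j => a j | inr j => b j end.
have -> : \prod_j a j * \prod_j b j = \prod_j c j.
  rewrite big_split_ord /=; congr (_ * _); apply: eq_bigr => j _; rewrite /c.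
    by rewrite -/(unsplit (inl j)) unsplitK.
  by rewrite -/(unsplit (inr j)) unsplitK.
apply: ideal_pow_prod => j; rewrite /c; case: (split j) => ?;
  [exact: Ia | exact: Ib].
Qed.

Lemma ideal_pow_mono (A : comPzRingType) (I : set A) s t :
  (s <= t)%N -> ideal_pow I t `<=` ideal_pow I s.
Proof.
move=> /subnKC <-; apply: ideal_gen_min; first exact: ideal_gen_ideal.
move=> _ [a Ia <-]; rewrite big_split_ord /= mulrC.
have [_ _ IM] : is_ideal (ideal_pow I s) by apply: ideal_gen_ideal.
by apply: IM; apply: ideal_pow_prod => j; apply: Ia.
Qed.

(** The m-adic filtration of [B].  Its late terms vanish when [m] is nilpotent, so
    an element is shown to be 0 by bounding below the step where it lies. *)
Definition ext_pow (R B : comPzRingType) (sigma : {rmorphism R -> B})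
    (m : set R) (t : nat) : set B :=
  ideal_gen [set sigma a | a in ideal_pow m t].

Lemma ext_pow_ideal (R B : comPzRingType) (sigma : {rmorphism R -> B})
    (m : set R) t : is_ideal (ext_pow sigma m t).
Proof. exact: ideal_gen_ideal. Qed.

Lemma ext_pow1 (R B : comPzRingType) (sigma : {rmorphism R -> B})
    (m : set R) a : m a -> ext_pow sigma m 1 (sigma a).
Proof.
move=> ma; apply: mem_ideal_gen; exists a => //.
have <- : \prod_(j < 1) a = a by rewrite big_ord1.
exact: ideal_pow_prod.
Qed.

Lemma ext_pow_one (R B : comPzRingType) (sigma : {rmorphism R -> B})
    (m : set R) : ext_pow sigma m 0 1.
Proof.
apply: mem_ideal_gen; exists 1; last by rewrite rmorph1.
have <- : \prod_(j < 0) (1 : R) = 1 by rewrite big_ord0.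
by apply: ideal_pow_prod => -[].
Qed.

Lemma ext_powM (R B : comPzRingType) (sigma : {rmorphism R -> B})
    (m : set R) s t x y :
  ext_pow sigma m s x -> ext_pow sigma m t y -> ext_pow sigma m (s + t) (x * y).
Proof.
apply: ideal_genM; first exact: ideal_gen_ideal.
move=> _ _ [a ma <-] [b mb <-]; rewrite -rmorphM; apply: mem_ideal_gen.
by exists (a * b) => //; apply: ideal_powM.
Qed.

Lemma ext_powX (R B : comPzRingType) (sigma : {rmorphism R -> B})
    (m : set R) t x :
  ext_pow sigma m 1 x -> ext_pow sigma m t (x ^+ t).
Proof.
move=> mx; elim: t => [|t IH]; first exact: ext_pow_one.
by rewrite exprS -add1n; apply: ext_powM.
Qed.

Lemma ext_pow_bigprod (R B : comPzRingType) (sigma : {rmorphism R -> B})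
    (m : set R) n (t : 'I_n -> nat) (x : 'I_n -> B) :
  (forall j, ext_pow sigma m (t j) (x j)) ->
  ext_pow sigma m (\sum_j t j)%N (\prod_j x j).
Proof.
move=> mx; elim/big_ind2: _ => //; first exact: ext_pow_one.
by move=> *; apply: ext_powM.
Qed.

Lemma ext_pow_eq0 (R B : comPzRingType) (sigma : {rmorphism R -> B})
    (m : set R) s t x :
  (forall a, ideal_pow m s a -> a = 0) -> (s <= t)%N ->
  ext_pow sigma m t x -> x = 0.
Proof.
move=> m0 le_st; apply: (@ideal_gen_min _ _ [set 0]).
  by split=> [//|? ? -> ->|? ? ->]; rewrite ?addr0 ?mulr0.
move=> _ [a ma <-]; rewrite (m0 a) ?rmorph0 //.
exact: (ideal_pow_mono le_st).
Qed.

(** This is where the floors come from: l contains l %/ i copies of i. *)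
Lemma ext_pow_expr (R B : comPzRingType) (sigma : {rmorphism R -> B})
    (m : set R) i l y :
  ext_pow sigma m 1 (y ^+ i) -> ext_pow sigma m (l %/ i) (y ^+ l).
Proof.
move=> my; rewrite {2}(divn_eq l i) exprD [(_ * i)%N]mulnC exprM mulrC.
by have [_ _ MM] := ext_pow_ideal sigma m (l %/ i); apply: MM; apply: ext_powX.
Qed.

(** * Powers of sums *)

Lemma prime_dvd_fact p i : prime p -> (p %| i`!)%N = (p <= i)%N.
Proof.
move=> p_pr; apply/idP/idP => [|le_pi]; last by rewrite dvdn_fact ?prime_gt0.
elim: i => [|i IH]; first by rewrite fact0 dvdn1 => /eqP p1; rewrite p1 in p_pr.
rewrite factS Euclid_dvdM // => /orP[/dvdn_leq-> //|/IH]; exact: leqW.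
Qed.

(** The cross terms keep the factor x y besides p: when y is itself a multiple of
    p and p^2 = 0, they all vanish. *)
Lemma exprD_prime (T : comPzRingType) p (x y : T) : prime p ->
  exists d, (x + y) ^+ p = x ^+ p + y ^+ p + p%:R * (x * y * d).
Proof.
move=> p_pr; rewrite exprDn.
case: p p_pr => // p p_pr; rewrite big_ord_recl big_ord_recr /= subn0 subnn.
rewrite !expr0 mulr1 mul1r bin0 binn !mulr1n.
exists (\sum_(i < p) x ^+ (p - i).-1 * y ^+ i *+ ('C(p.+1, i.+1) %/ p.+1)).
rewrite -[RHS]addrA; congr (_ + _); rewrite [LHS]addrC; congr (_ + _).
rewrite mulrA mulr_sumr; apply: eq_bigr => i _; rewrite /bump /= add1n subSS.
have lt_ip : (i < p)%N by [].
set D := (_ %/ _)%N.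
have -> : 'C(p.+1, i.+1) = (p.+1 * D)%N by rewrite mulnC divnK ?prime_dvd_bin.
rewrite -[in LHS](@prednK (p - i)) ?subn_gt0 // !exprS mulrACA.
by rewrite mulr_natl mulrnAl mulrnAr mulrnAC mulrnA.
Qed.

Lemma exprD_primeX (T : comPzRingType) p t (x y : T) : prime p ->
  exists d, (x + y) ^+ (p ^ t) = x ^+ (p ^ t) + y ^+ (p ^ t) + p%:R * d.
Proof.
move=> p_pr; elim: t => [|t [d IH]].
  by exists 0; rewrite !expr1 mulr0 addr0.
rewrite expnSr !exprM IH.
have [a ->] := exprD_prime (x ^+ (p ^ t) + y ^+ (p ^ t)) (p%:R * d) p_pr.
have [b ->] := exprD_prime (x ^+ (p ^ t)) (y ^+ (p ^ t)) p_pr.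
rewrite (_ : (p%:R * d) ^+ p = p%:R * (d * (p%:R * d) ^+ p.-1)); last first.
  by rewrite mulrA -exprS prednK ?prime_gt0.
by eexists; rewrite -!addrA -!mulrDr; reflexivity.
Qed.

Lemma expr_sum_primeX (T : comPzRingType) p t (I : Type) (s : seq I)
    (z : I -> T) : prime p ->
  exists d, (\sum_(i <- s) z i) ^+ (p ^ t) =
    \sum_(i <- s) z i ^+ (p ^ t) + p%:R * d.
Proof.
move=> p_pr; elim: s => [|i s [d IH]].
  by exists 0; rewrite !big_nil mulr0 addr0 expr0n expn_eq0 eqn0Ngt prime_gt0.
rewrite !big_cons.
have [a ->] := exprD_primeX t (z i) (\sum_(j <- s) z j) p_pr.
by rewrite IH; eexists; rewrite -!addrA -mulrDr; reflexivity.
Qed.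

(** With [inv_fact i] the inverse of i!, this is exp(zX) without its terms of
    degree p and more, which would need the inverse of p.  A product of such
    series has the divided multinomial sums as coefficients. *)
Definition truncexp (T : comNzRingType) (p : nat) (inv_fact : nat -> T) (z : T) :
    {poly T} :=
  \poly_(i < p) (inv_fact i * z ^+ i).

(** Below degree p the product is exp((\sum z)X).  In degree p, each factor misses
    its term z^p / p!, and multiplying by p! shows what is missing: \sum z^p. *)
Lemma coef_prod_truncexp (T : comNzRingType) p (inv_fact : nat -> T) (s : seq T) :
  (0 < p)%N -> (forall i, (i < p)%N -> i`!%:R * inv_fact i = 1) ->
  let Q := \prod_(z <- s) truncexp p inv_fact z in
  (forall N, (N < p)%N -> N`!%:R * Q`_N = (\sum_(z <- s) z) ^+ N) /\
  p`!%:R * Q`_p = (\sum_(z <- s) z) ^+ p - \sum_(z <- s) z ^+ p.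
Proof.
move=> p_gt0 ifP Q; rewrite {}/Q; elim: s => [|z s [IH IHp]].
  rewrite !big_nil; split=> [N _|].
    by rewrite coef1 expr0n; case: N => [|N]; rewrite ?fact0 ?mulr1 ?mulr0.
  by rewrite coef1 expr0n -(prednK p_gt0) mulr0 subr0.
rewrite !big_cons; set Q := \prod_(y <- s) _ in IH IHp *.
set S := \sum_(y <- s) y in IH IHp *.
have term N j : (j <= N)%N -> (j < p)%N -> (N - j < p)%N ->
    N`!%:R * ((truncexp p inv_fact z)`_j * Q`_(N - j)) =
      S ^+ (N - j) * z ^+ j *+ 'C(N, j).
  move=> le_jN lt_jp lt_Njp; rewrite coef_poly lt_jp -IH // -(bin_fact le_jN).
  rewrite -[RHS]mulr_natl !natrM; move: (ifP j lt_jp).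
  move: (j`!%:R) ((N - j)`!%:R) ('C(N, j)%:R) Q`_(N - j) (z ^+ j) => a b c x y.
  by move=> af1; rewrite -[RHS]mul1r -af1; ring.
split=> [N lt_Np|].
  rewrite coefM mulr_sumr [z + S]addrC exprDn; apply: eq_bigr => -[j /= lt_jN] _.
  by apply: term => //; [apply: leq_trans lt_Np | apply: leq_ltn_trans lt_Np;
    rewrite leq_subr].
rewrite coefM mulr_sumr [z + S]addrC exprDn.
clearbody Q; case: p p_gt0 ifP IH IHp term => // p _ ifP IH IHp term.
(* On the left, the term of index p is absent, and the term of index 0 is given
   by the induction hypothesis; the other ones match those of the binomial
   formula. *)
rewrite [in LHS]big_ord_recl [in LHS]big_ord_recr /=.
rewrite [in RHS]big_ord_recl [in RHS]big_ord_recr /= !subn0 !subnn !expr0 !mulr1 mul1r.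
rewrite bin0 binn !mulr1n !coef_poly /= ltnn mul0r mulr0 addr0.
rewrite !expr0 mulr1 -[inv_fact 0%N]mul1r (ifP 0%N) // mul1r IHp.
rewrite opprD !addrA addrK [LHS]addrAC; congr (_ + _ - _).
apply: eq_bigr => -[j /= lt_jp] _; apply: term; rewrite /bump /=.
- exact: leqW.
- exact: lt_jp.
- by rewrite add1n subSS ltnS leq_subr.
Qed.

Lemma multinomial_prime (T : comNzRingType) p m (inv_fact : nat -> T)
    (z : 'I_m -> T) :
  (0 < p)%N -> (forall i, (i < p)%N -> i`!%:R * inv_fact i = 1) ->
  p`!%:R * (\sum_(l : {ffun 'I_m -> 'I_p} | (\sum_(j < m) l j)%N == p)
              \prod_(j < m) (inv_fact (l j) * z j ^+ l j)) =
  (\sum_(j < m) z j) ^+ p - \sum_(j < m) z j ^+ p.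
Proof.
move=> p_gt0 ifP.
have [_] := coef_prod_truncexp (codom z) p_gt0 ifP.
rewrite !big_map -!enumT !big_enum /= => <-; congr (_ * _).
transitivity ((\prod_(j < m) truncexp p inv_fact (z j))`_p); last by [].
under [in RHS]eq_bigr do rewrite /truncexp poly_def.
rewrite bigA_distr_bigA coef_sum big_mkcond; apply: eq_bigr => l _.
rewrite scaler_prod prodrXr coefZ coefXn eq_sym.
by case: eqP => _; rewrite ?mulr1 ?mulr0.
Qed.

(** * Polynomials in characteristic p *)

Lemma mpoly_expr_pchar (k : comNzRingType) (n p t : nat) (f : {mpoly k[n]}) :
  p \in [pchar k] ->
  f ^+ (p ^ t) =
    \sum_(m <- msupp f) f@_m ^+ (p ^ t) *: 'X_[(m *+ (p ^ t))%MM].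
Proof.
move=> pk; have pf : p \in [pchar {mpoly k[n]}] by rewrite (rmorph_pchar (@mpolyC n k)).
have p_pr := pcharf_prime pk.
have P_nat : [pchar {mpoly k[n]}].-nat (p ^ t)%N.
  by rewrite pnatX (eq_pnat _ (pcharf_eq pf)) pnat_id.
rewrite [in LHS](mpolyE f).
rewrite (big_morph (fun g => g ^+ (p ^ t)) (id1 := 0) (op1 := +%R)).
- by apply: eq_bigr => m _; rewrite exprZn mpolyXn.
- by move=> g h; apply: exprDn_pchar.
- by rewrite expr0n expn_eq0 eqn0Ngt prime_gt0.
Qed.

Lemma mulmn_inj n P : (0 < P)%N -> injective (fun m : 'X_{1..n} => (m *+ P)%MM).
Proof.
move=> P_gt0 m1 m2 /mnmP eq_mm; apply/mnmP => j; have := eq_mm j.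
by rewrite !mulmnE => /eqP; rewrite eqn_pmul2r // => /eqP.
Qed.

Lemma mcoeff_expr_pchar (k : comNzRingType) (n p t : nat) (f : {mpoly k[n]}) m :
  p \in [pchar k] -> (f ^+ (p ^ t))@_(m *+ (p ^ t)) = f@_m ^+ (p ^ t).
Proof.
move=> pk; have P_gt0 : (0 < p ^ t)%N by rewrite expn_gt0 prime_gt0 ?(pcharf_prime pk).
rewrite mpoly_expr_pchar // raddf_sum /=.
under eq_bigr do rewrite mcoeffZ mcoeffX (inj_eq (mulmn_inj P_gt0)).
have [mf|mf] := boolP (m \in msupp f).
  rewrite (big_rem m) //= eqxx mulr1 big_seq big1 ?addr0 // => m'.
  by rewrite mem_rem_uniq ?msupp_uniq // inE => /andP[/negbTE-> _]; rewrite mulr0.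
rewrite (memN_msupp_eq0 mf) expr0n eqn0Ngt P_gt0 big_seq big1 // => m' m'f.
by case: eqP m'f mf => [->->|]; rewrite ?mulr0.
Qed.

(** In general a power mixes monomials; a domain of characteristic p is what makes
    the support of the p^t-th power an exact dilate.  Only a permutation holds, the
    order of [msupp] being unspecified. *)
Lemma msupp_expr_pchar (k : idomainType) (n p t : nat) (f : {mpoly k[n]}) :
  p \in [pchar k] ->
  perm_eq (msupp (f ^+ (p ^ t))) [seq (m *+ (p ^ t))%MM | m <- msupp f].
Proof.
move=> pk; have P_gt0 : (0 < p ^ t)%N by rewrite expn_gt0 prime_gt0 ?(pcharf_prime pk).
apply: uniq_perm; rewrite ?(map_inj_uniq (mulmn_inj P_gt0)) ?msupp_uniq // => L.
apply/idP/mapP => [|[m mf ->]]; last first.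
  by rewrite mcoeff_msupp mcoeff_expr_pchar // expf_neq0 -?mcoeff_msupp.
rewrite mcoeff_msupp mpoly_expr_pchar // raddf_sum /=.
apply: contraNP => noL; rewrite big_seq big1 // => m mf.
rewrite mcoeffZ mcoeffX; case: eqP => [eqL|_]; last by rewrite mulr0.
by case: noL; exists m.
Qed.

(** * The computation in a deformation *)

(** Flatness appears here through its consequence on the annihilator of p.  The
    computation takes place in B rather than in polynomials over R, because the
    relations of A0 become elements of m_R B there, and so nilpotent. *)
Lemma w_lift_eq0 (R : comUnitRingType) (k : fieldType)
    (pi : {rmorphism R -> k}) (p r e n : nat) (i : 'I_n -> nat)
    (f0 : {mpoly k[n]}) (A0 : comPzRingType)
    (proj : {rmorphism {mpoly k[n]} -> A0}) (B : comNzRingType)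
    (sigma : {rmorphism R -> B}) (psi : {rmorphism B -> A0}) :
  let m_R := nonunits (R := R) in
  is_quotient_map m_R pi ->
  p \in [pchar k] -> (0 < r)%N ->
  (forall x, m_R x -> p%:R * x = 0) ->
  (forall x, ideal_pow m_R e.+1 x -> x = 0) ->
  (e < p ^ r)%N ->
  (forall l : 'X_{1..n}, l \in msupp f0 ->
     (e < \sum_(j < n) (p ^ r * l j) %/ i j)%N) ->
  (forall a, psi (sigma a) = proj (pi a)%:MP) ->
  (forall t, exists b, psi b = t) ->
  (forall b, psi b = 0 -> ext_pow sigma m_R 1 b) ->
  (forall b, p%:R * b = 0 -> psi b = 0) ->
  (forall j, proj ('X_j ^+ i j) = 0) ->
  proj f0 = 0 ->
  proj (w_ p (f0 ^+ (p ^ (r - 1)))) = 0.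
Proof.
move=> m_R [pi_onto pi0] pk r_gt0 pm0 me0 lt_eq floorP psi_sigma psi_onto.
move=> ker_psi annp proj_x proj_f0.
have p_pr := pcharf_prime pk; have p_gt0 := prime_gt0 p_pr.
have unitP a : pi a != 0 -> a \is a GRing.unit.
  by move=> nz; apply: contraT => ?; case/eqP: nz; apply/pi0.
have fact_neq0 l : (l < p)%N -> (l`!%:R : k) != 0.
  by move=> lt_lp; rewrite -(dvdn_pcharf pk) prime_dvd_fact // -ltnNge.
have fact_unit l : (l < p)%N -> (l`!%:R : R) \is a GRing.unit.
  by move=> lt_lp; apply: unitP; rewrite rmorph_nat fact_neq0.
have pp0 : p%:R * p%:R = 0 :> B.
  rewrite -(rmorph_nat sigma) -rmorphM pm0 ?rmorph0 //.
  by apply/pi0; rewrite rmorph_nat pcharf0.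
have [u uK] := choice pi_onto.
have [y psi_y] := choice (fun j : 'I_n => psi_onto (proj 'X_j)).
pose ym (m : 'X_{1..n}) := \prod_j y j ^+ m j.
have psi_ym m : psi (ym m) = proj 'X_[m].
  rewrite mpolyXE_id !rmorph_prod; apply: eq_bigr => j _.
  by rewrite !rmorphXn psi_y.
pose P := (p ^ (r - 1))%N.
have qE : (p ^ r = P * p)%N by rewrite -expnSr subn1 prednK.
have P_gt0 : (0 < P)%N by rewrite expn_gt0 p_gt0.
(* The coefficients of f0^P are lifted by P-th powers of lifts: with arbitrary
   lifts, the sum would differ from F^P by an element of m_R B only, whose p-th
   power has no reason to vanish. *)
pose t m := sigma (u f0@_m) * ym m.
have psi_t m : psi (t m) = proj (f0@_m *: 'X_[m]).
  by rewrite rmorphM psi_sigma uK psi_ym -rmorphM mul_mpolyC.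
pose F := \sum_(m <- msupp f0) t m.
have Fq0 : F ^+ (p ^ r) = 0.
  apply: (ext_pow_eq0 me0 lt_eq (sigma := sigma)); apply: ext_powX; apply: ker_psi.
  by rewrite /F rmorph_sum (eq_bigr _ (fun m _ => psi_t m)) -rmorph_sum -mpolyE.
have tq0 m : m \in msupp f0 -> t m ^+ (p ^ r) = 0.
  move=> mf; rewrite exprMn -prodrXl.
  suff -> : \prod_j (y j ^+ m j) ^+ (p ^ r) = 0 by rewrite mulr0.
  apply: (ext_pow_eq0 me0 (floorP m mf) (sigma := sigma)).
  apply: ext_pow_bigprod => j; rewrite -exprM mulnC; apply: ext_pow_expr; apply: ker_psi.
  by rewrite rmorphXn psi_y -rmorphXn.
set g := f0 ^+ _.
(* [Z L] is the lift of the monomial L of f0^P; the exponents of L are multiples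
   of P, so that [root] divides exactly. *)
pose root (L : 'X_{1..n}) : 'X_{1..n} := [multinom (L j %/ P)%N | j < n].
have rootK m : root (m *+ P)%MM = m.
  by apply/mnmP => j; rewrite mnmE mulmnE mulnK.
pose Z L := t (root L) ^+ P.
have g_supp := msupp_expr_pchar (r - 1) f0 pk; rewrite -/P -/g in g_supp.
have ZP L : L \in msupp g -> psi (Z L) = proj (g@_L *: 'X_[L]) /\ Z L ^+ p = 0.
  rewrite (perm_mem g_supp) => /mapP[m mf ->]; split.
    by rewrite /Z rootK rmorphXn psi_t -rmorphXn exprZn mpolyXn mcoeff_expr_pchar.
  by rewrite /Z rootK -exprM -qE tq0.
have sumZ : \sum_(L <- msupp g) Z L = \sum_(m <- msupp f0) t m ^+ P.
  by rewrite (perm_big _ g_supp) big_map; apply: eq_bigr => m _; rewrite /Z rootK.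
have sumZp : (\sum_(L <- msupp g) Z L) ^+ p = 0.
  have [c Fc] := expr_sum_primeX (r - 1) (msupp f0) t p_pr.
  rewrite -/P -/F -sumZ in Fc.
  rewrite (_ : \sum_(L <- _) _ = F ^+ P + p%:R * - c); last first.
    by rewrite Fc mulrN addrK.
  have [d ->] := exprD_prime (F ^+ P) (p%:R * - c) p_pr.
  have -> : p%:R * (F ^+ P * (p%:R * - c) * d) = p%:R * p%:R * (F ^+ P * - c * d).
    by move: (p%:R : B) => a; ring.
  rewrite -exprM -qE Fq0 add0r pp0 mul0r addr0 exprMn.
  by rewrite -[X in p%:R ^+ X](subnKC (prime_gt1 p_pr)) exprD expr2 pp0 !mul0r.
pose inv_fact l := sigma (l`!%:R^-1).
have inv_factP l : (l < p)%N -> l`!%:R * inv_fact l = 1.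
  by move=> lt_lp; rewrite -(rmorph_nat sigma) -rmorphM divrr ?rmorph1 ?fact_unit.
pose z (j : 'I_(size (msupp g))) := Z (nth 0%MM (msupp g) j).
have sum_msupp (h : 'X_{1..n} -> B) :
    \sum_(L <- msupp g) h L = \sum_(j < size (msupp g)) h (nth 0%MM (msupp g) j).
  by rewrite (big_nth 0%MM) big_mkord.
have := multinomial_prime z p_gt0 inv_factP.
set W := (X in _ * X = _) => pW.
have W0 : p%:R * W = 0.
  have -> : p%:R * W = inv_fact p.-1 * (p`!%:R * W).
    have -> : (p`! = p * p.-1`!)%N by rewrite -{1}(prednK p_gt0) factS prednK.
    rewrite natrM.
    rewrite [RHS](_ : _ = (p.-1`!%:R * inv_fact p.-1) * (p%:R * W)); last first.
      by move: (p.-1`!%:R) (p%:R : B) => a b; ring.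
    by rewrite inv_factP ?mul1r // prednK.
  rewrite pW /z -(sum_msupp Z) sumZp -(sum_msupp (fun L => Z L ^+ p)).
  by rewrite big_seq big1 ?subr0 ?mulr0 // => L /ZP[].
rewrite -(annp W W0) /W /w_ !rmorph_sum; apply: eq_bigr => l _ /=.
rewrite big_split -mul_mpolyC !rmorphM !rmorph_prod /=; congr (_ * _).
  rewrite -prodfV 2!rmorph_prod; apply: eq_bigr => j _ /=.
  by rewrite psi_sigma (rmorphV pi) ?fact_unit // (rmorph_nat pi).
apply: eq_bigr => j _; rewrite (rmorphXn proj) (rmorphXn psi); congr (_ ^+ _).
by rewrite /z; have [-> _] := ZP _ (mem_nth 0%MM (ltn_ord j)).
Qed.

(** * Tensor products and flatness *)

(** The universal property of the tensor product, for maps that are bilinear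
    modulo an ideal: it detects that an element is nonzero in the tensor product
    without forming a quotient ring. *)
Lemma tensor_eq_bilinear (R : Type) (M N : zmodType) (actM : R -> M -> M)
    (actN : R -> N -> N) (B : comPzRingType) (K : set B) (beta : M -> N -> B) :
  is_ideal K ->
  (forall n, K (beta 0 n)) ->
  (forall m m' n, K (beta (m + m') n - (beta m n + beta m' n))) ->
  (forall m n n', K (beta m (n + n') - (beta m n + beta m n'))) ->
  (forall a m n, K (beta (actM a m) n - beta m (actN a n))) ->
  forall s t, tensor_eq actM actN s t ->
  K (\sum_(x <- s) beta x.1 x.2 - \sum_(x <- t) beta x.1 x.2).
Proof.
move=> idK b0 bl br bs; have [K0 KD KM] := idK.
have KN x : K x -> K (- x) by rewrite -mulN1r; apply: KM.
move=> s t; elim=> {s t} [s|s t _|s t u _ st _ tu|s s' t t' _ ss _ tt|s t|n|m m' n|m n n'|a m n].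
- by rewrite subrr.
- by move/KN; rewrite opprB.
- by rewrite -(subrKA (\sum_(x <- t) beta x.1 x.2)); apply: KD.
- by rewrite !big_cat /= opprD addrACA; apply: KD.
- by rewrite !big_cat /= addrC subrr.
- by rewrite big_seq1 big_nil subr0; apply: b0.
- by rewrite !big_cons !big_nil !addr0; apply: bl.
- by rewrite !big_cons !big_nil !addr0; apply: br.
- by rewrite !big_seq1; apply: bs.
Qed.

(** B (x) k is B / m_R B.  A set-theoretic section u of pi makes b (x) c |-> b u(c)
    bilinear modulo m_R B.  The base change and flatness have B on opposite sides
    of the tensor product, whence the two forms. *)
Lemma tensor_residue (R : comNzRingType) (k : nzRingType)
    (pi : {rmorphism R -> k}) (m_R : set R) (B : comPzRingType)
    (sigma : {rmorphism R -> B}) (b : B) :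
  (forall c, exists a, pi a = c) -> (forall a, pi a = 0 <-> m_R a) ->
  tensor_eq (fun a b => sigma a * b) (fun a c => pi a * c) [:: (b, 1)] [::] \/
  tensor_eq (fun a c => pi a * c) (fun a b => sigma a * b) [:: (1, b)] [::] ->
  ext_pow sigma m_R 1 b.
Proof.
move=> pi_onto pi0; have [u uK] := choice pi_onto.
set K := ext_pow sigma m_R 1; have idK : is_ideal K by apply: ext_pow_ideal.
have [K0 KD KM] := idK.
have Km a : pi a = 0 -> K (sigma a) by move=> /pi0 ma; apply: ext_pow1.
pose beta c b := b * sigma (u c).
have b0l n : K (beta 0 n) by apply: KM; apply: Km; rewrite uK.
have bl c c' n : K (beta (c + c') n - (beta c n + beta c' n)).
  rewrite /beta -mulrDr -mulrBr -rmorphD -rmorphB; apply: KM; apply: Km.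
  by rewrite rmorphB rmorphD !uK subrr.
have br c n n' : K (beta c (n + n') - (beta c n + beta c n')).
  by rewrite /beta mulrDl subrr.
have bs a c n : K (beta (pi a * c) n - beta c (sigma a * n)).
  rewrite /beta [sigma a * n]mulrC -mulrA -rmorphM -mulrBr -rmorphB; apply: KM; apply: Km.
  by rewrite rmorphB rmorphM !uK subrr.
suff: K (beta 1 b) -> K b.
  move=> Kb [|] tens; apply: Kb.
    have := @tensor_eq_bilinear _ _ _ _ _ _ K (fun b c => beta c b) idK _ _ _ _ _ _ tens.
    rewrite big_seq1 big_nil subr0; apply=> // => [n|a n c].
      by rewrite /beta mul0r.
    by rewrite -opprB -mulN1r; apply: KM.
  have := @tensor_eq_bilinear _ _ _ _ _ _ K beta idK _ _ _ _ _ _ tens.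
  by rewrite big_seq1 big_nil subr0; apply.
move=> Kb; rewrite -[b](subKr (beta 1 b)); apply: (ideal_sub idK) => //.
rewrite /beta -[X in _ - X]mulr1 -(rmorph1 sigma) -mulrBr -rmorphB.
by apply: KM; apply: Km; rewrite rmorphB uK rmorph1 subrr.
Qed.

(** A copy of k, to carry the R-module structure that comes from pi. *)
Definition residue_module (R : nzRingType) (k : nzRingType)
  (pi : {rmorphism R -> k}) : Type := k.

HB.instance Definition _ (R k : nzRingType) (pi : {rmorphism R -> k}) :=
  GRing.Zmodule.on (residue_module pi).

Definition residue_act (R k : nzRingType) (pi : {rmorphism R -> k}) (a : R)
  (c : residue_module pi) : residue_module pi := pi a * (c : k).

Lemma residue_actA (R k : nzRingType) (pi : {rmorphism R -> k}) a b
    (c : residue_module pi) :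
  residue_act a (residue_act b c) = residue_act (a * b) c.
Proof. by rewrite /residue_act rmorphM mulrA. Qed.

Lemma residue_act1 (R k : nzRingType) (pi : {rmorphism R -> k}) :
  left_id 1 (@residue_act R k pi).
Proof. by move=> c; rewrite /residue_act rmorph1 mul1r. Qed.

Lemma residue_actDr (R k : nzRingType) (pi : {rmorphism R -> k}) :
  right_distributive (@residue_act R k pi) +%R.
Proof. by move=> a b c; rewrite /residue_act mulrDr. Qed.

Lemma residue_actDl (R k : nzRingType) (pi : {rmorphism R -> k}) c :
  {morph (@residue_act R k pi)^~ c : a b / a + b}.
Proof. by move=> a b; rewrite /residue_act rmorphD mulrDl. Qed.

HB.instance Definition _ (R k : nzRingType) (pi : {rmorphism R -> k}) :=
  GRing.Zmodule_isLmodule.Build R (residue_module pi) (@residue_actA R k pi)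
    (@residue_act1 R k pi) (@residue_actDr R k pi) (@residue_actDl R k pi).

(** When g is killed by exactly the maximal ideal, c |-> u(c) g is a well-defined
    linear injection of k into R; tensored with B, it becomes multiplication by g
    from B / m_R B to B. *)
Lemma flat_annihilator (R : comUnitRingType) (k : fieldType)
    (pi : {rmorphism R -> k}) (B : comPzRingType) (sigma : {rmorphism R -> B})
    (g : R) (b : B) :
  let m_R := nonunits (R := R) in
  is_quotient_map m_R pi -> flat_morphism sigma ->
  g != 0 -> (forall x, m_R x -> g * x = 0) ->
  sigma g * b = 0 -> ext_pow sigma m_R 1 b.
Proof.
move=> m_R [pi_onto pi0] flat g_neq0 gm0 gb0.
have [u uK] := choice pi_onto.
pose h (c : residue_module pi) : R^o := u c * g.
have gmod x y : pi x = pi y -> x * g = y * g.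
  move=> eq_xy; apply/eqP; rewrite -subr_eq0 -mulrBl mulrC gm0 //; apply/pi0.
  by rewrite rmorphB eq_xy subrr.
have h_lin : linear h.
  move=> a c c'; rewrite /h -[a *: (u c * g : R^o)]/(a * (u c * g)) mulrA -mulrDl; apply: gmod.
  by rewrite rmorphD rmorphM !uK.
pose hL : {linear residue_module pi -> R^o} :=
  HB.pack h (GRing.isLinear.Build _ _ _ _ h h_lin).
have h_inj : injective hL.
  move=> c c' /eqP; rewrite -subr_eq0 -mulrBl => ucc; apply/eqP.
  rewrite -subr_eq0 -[c]uK -[c']uK -rmorphB; apply: contraT => nz.
  have unit_u : u c - u c' \is a GRing.unit.
    by apply: contraT => ?; case/eqP: nz; apply/pi0.
  by move: ucc; rewrite -(mulr0 (u c - u c')) (inj_eq (mulrI unit_u)) (negbTE g_neq0).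
apply: (tensor_residue pi_onto pi0); right.
apply: (flat _ _ hL h_inj [:: (1, b)]) => /=.
have -> : h 1 = g *: (1 : R^o).
  by rewrite /h (@gmod _ 1) ?uK ?rmorph1 // mul1r -[RHS]/(g * 1) mulr1.
(* g (x) b = 1 (x) g b = 1 (x) 0 = 0 (x) 0. *)
apply: tensor_trans; first exact: tensor_scale.
rewrite /= gb0 -[X in (_, X)](mul0r 0) -(rmorph0 sigma).
apply: tensor_trans; first by apply: tensor_sym; apply: tensor_scale.
by rewrite scale0r; apply: tensor_0l.
Qed.

(** * From a lift of the spectrum to a lift of the algebra *)

Lemma rmorph_inverse (A B : comPzRingType) (f : {rmorphism A -> B}) :
  bijective f -> exists g : {rmorphism B -> A}, cancel f g /\ cancel g f.
Proof.
move=> [g fK gK].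
have gB : {morph g : x y / x - y} by exact: (can2_zmod_morphism fK gK).
have gM : GRing.monoid_morphism g by exact: (can2_monoid_morphism fK gK).
pose aB := GRing.isZmodMorphism.Build B A g gB.
pose aM := GRing.isMonoidMorphism.Build B A g gM.
pose G : {rmorphism B -> A} := HB.pack g aB aM.
by exists G.
Qed.

Lemma ideal_preim (A B : comPzRingType) (f : {rmorphism A -> B}) (I : set B) :
  is_ideal I -> is_ideal (f @^-1` I).
Proof.
move=> [I0 ID IM]; split=> [/=|x y /= Ix Iy|a x /= Ix]; first by rewrite rmorph0.
  by rewrite rmorphD; apply: ID.
by rewrite rmorphM; apply: IM.
Qed.

Lemma prime_ideal_preim (A B : comPzRingType) (f : {rmorphism A -> B}) (P : set B) :
  is_prime_ideal P -> is_prime_ideal (f @^-1` P).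
Proof.
move=> [idP P1 PP]; split=> [|/=|x y /=]; first exact: ideal_preim.
  by rewrite rmorph1.
by rewrite rmorphM => /PP.
Qed.

Definition nilradical (A : comPzRingType) : set A := [set x | exists N, x ^+ N = 0].

Lemma nilradical_ideal (A : comPzRingType) : is_ideal (@nilradical A).
Proof.
split=> [|x y [a xa] [b yb]|c x [a xa]]; first by exists 1%N; rewrite expr1.
  exists (a + b)%N; rewrite exprDn big1 // => -[j /= _] _.
  have [le_bj|lt_jb] := leqP b j.
    by rewrite -(subnKC le_bj) [y ^+ _]exprD yb mul0r mulr0 mul0rn.
  have le_a : (a <= a + b - j)%N by rewrite -addnBA ?leq_addr // ltnW.
  by rewrite -(subnKC le_a) exprD xa !mul0r mul0rn.
by exists a; rewrite exprMn xa mulr0.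
Qed.

Lemma nilradical_sub_prime (A : comPzRingType) (P : set A) :
  is_prime_ideal P -> @nilradical A `<=` P.
Proof.
move=> [[P0 _ _] P1 PP] x [N xN]; have : P (x ^+ N) by rewrite xN.
by elim: N {xN} => [|N IH]; rewrite ?expr0 // exprS => /PP[].
Qed.

(** Modulo nilpotents every element is a scalar, and so zero or a unit; hence the
    nilradical is the maximal ideal and lies in every prime. *)
Lemma local_prime_ideals (k : fieldType) (A : comPzRingType)
    (kappa : {rmorphism k -> A}) :
  (1 : A) <> 0 -> (forall a, exists c, nilradical (a - kappa c)) ->
  forall P : set A, is_prime_ideal P <-> P = @nilradical A.
Proof.
move=> A1 kA P; have idN := nilradical_ideal A; have [N0 ND NM] := idN.
have N1 : ~ nilradical (1 : A) by move=> [N]; rewrite expr1n.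
have cN c (a : A) : nilradical (a - kappa c) -> c = 0 -> nilradical a.
  by move=> + c0; rewrite c0 rmorph0 subr0.
have kN (Q : set A) c : is_ideal Q -> ~ Q 1 -> Q (kappa c) -> c = 0.
  move=> [_ _ QM] Q1 Qc; apply: contra_notP Q1 => /eqP c0.
  by rewrite -(rmorph1 kappa) -(mulVf c0) rmorphM; apply: QM.
split=> [primeP|->].
  have [idP P1 _] := primeP; have nilP := nilradical_sub_prime primeP.
  apply/seteqP; split=> // a Pa; have [c ac] := kA a.
  apply: (cN c) => //; apply: (kN P) => //.
  rewrite -[kappa c](subKr a); apply: (ideal_sub idP) => //; exact: nilP.
split=> // x y xy; have [c xc] := kA x; have [d yd] := kA y.
suff /eqP : c * d = 0.
  by rewrite mulf_eq0 => /orP[]/eqP z0; [left; apply: (cN c)|right; apply: (cN d)].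
apply: (kN (@nilradical A)) => //; rewrite rmorphM.
have -> : kappa c * kappa d = x * y - (y * (x - kappa c) + kappa c * (y - kappa d)).
  by ring.
by apply: (ideal_sub idN) => //; apply: ND; apply: NM.
Qed.

Lemma ideal_of_vars (k : comNzRingType) n (Q : set {mpoly k[n]}) f :
  is_ideal Q -> (forall j, Q 'X_j) -> f@_0%MM = 0 -> Q f.
Proof.
move=> idQ QX f0; have [_ _ QM] := idQ; rewrite [f]mpolyE big_seq.
apply: (ideal_sum _ idQ) => m; rewrite mcoeff_msupp => fm.
rewrite -mul_mpolyC; apply: (QM).
have /existsP[j mj] : [exists j, m j != 0%N].
  apply: contraR fm => /existsPn m0; suff -> : m = 0%MM by rewrite f0.
  by apply/mnmP => j; rewrite mnm0E; apply/eqP; have := m0 j; rewrite negbK.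
have -> : m = (m - U_(j) + U_(j))%MM by rewrite submK // lep1mP.
by rewrite mpolyXD; apply: QM.
Qed.

Lemma res_full_bij (X : ringed_space) (U : opens X) :
  (forall x, opens_set U x) -> bijective (@resT X U).
Proof.
move=> Ufull; have TU : opensT X `<=` U by move=> x _; apply: Ufull.
exists (res TU) => s; rewrite /resT (res_comp _ _ (@subset_refl _ _)) res_id //.
Qed.

(** Spec A0 is a single point x, so its whole space is the inverse image of any
    affine open V around f x.  Thus the sections over V lift A0. *)
Lemma liftable_local (R : comUnitRingType) (k : fieldType)
    (pi : {rmorphism R -> k}) (A0 : comPzRingType) (kappa : {rmorphism k -> A0}) :
  (1 : A0) <> 0 -> (forall a, exists c, nilradical (a - kappa c)) ->
  (forall c, exists a, pi a = c) ->
  liftable pi kappa ->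
  exists (B : comPzRingType) (sigma : {rmorphism R -> B})
         (psi : {rmorphism B -> A0}),
    [/\ flat_morphism sigma,
        forall a, psi (sigma a) = kappa (pi a),
        forall t, exists b, psi b = t
      & forall b, psi b = 0 ->
          tensor_eq (fun a b => sigma a * b) (fun a c => pi a * c) [:: (b, 1)] [::]].
Proof.
move=> A1 kA pi_onto [X [Y [gamma [sigma [f [specX schY flatY _ [comm bc]]]]]]].
have [affX gamma_bij] := specX.
have [ginv [gammaK ginvK]] := rmorph_inverse gamma_bij.
have primeA := local_prime_ideals A1 kA.
pose N : set (sections (opensT X)) := ginv @^-1` @nilradical A0.
have primeN : is_prime_ideal N by apply: prime_ideal_preim; apply/primeA.
have primeU P : is_prime_ideal P -> P = N.
  move=> /(prime_ideal_preim gamma) /primeA PN; rewrite /N -PN.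
  by apply/seteqP; split=> s /=; rewrite ginvK.
have [x [[_ Nx] xU]] := affine_point affX primeN.
have X1 x' : x = x'.
  by apply: xU; split=> //; apply/esym/primeU; apply: affine_prime affX _ _.
have [V [Vx affV]] := schY (f x).
have Vfull x' : opens_set (Defs.preim f V) x' by rewrite -(X1 x').
have [rinv [resK rinvK]] := rmorph_inverse (res_full_bij Vfull).
have [_ onto ker] := bc V affV.
have rinj : injective rinv by apply: can_inj rinvK.
have ginj : injective ginv by apply: can_inj ginvK.
pose psi : {rmorphism sections V -> A0} := ginv \o (rinv \o comor f V).
have psi_sigma a : psi (resT V (sigma a)) = kappa (pi a).
  by rewrite /psi /= comm resK gammaK.
exists (sections V), (resT V \o sigma), psi; split=> //.
- exact: flatY.
- move=> t; have [s st] := onto (resT (Defs.preim f V) (gamma t)).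
  have [u uK] := choice pi_onto.
  exists (\sum_(x <- s) x.1 * resT V (sigma (u x.2))).
  rewrite -[t]gammaK -[gamma t]resK -st; rewrite /psi /= !rmorph_sum.
  apply: eq_bigr => y _; rewrite !rmorphM /= comm uK; done.
- move=> b psi0; apply: ker; rewrite big_seq1 /= !rmorph1 mulr1.
  by apply: rinj; apply: ginj; rewrite !rmorph0.
Qed.

(** Univariate polynomials require a nontrivial coefficient ring, while sections
    over an open set may form the zero ring. *)
Lemma nonzero_ring (B : comPzRingType) :
  (1 : B) <> 0 -> exists B' : comNzRingType, B = B' :> comPzRingType.
Proof.
move=> /eqP B1; pose nz := GRing.PzSemiRing_isNonZero.Build B B1.
pose B' : comNzRingType := HB.pack_for comNzRingType B nz.
by exists B'; rewrite /B' /nz; case: B B1 {nz B'} => ? [].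
Qed.

Theorem theorem3p3 (R : comUnitRingType) (k : fieldType)
  (pi : {rmorphism R -> k}) (p r q e n : nat) (i : 'I_n -> nat)
  (I : set {mpoly k[n]}) (f0 : {mpoly k[n]})
  (A0 : comPzRingType) (proj : {rmorphism {mpoly k[n]} -> A0}) :
  let m_R := nonunits (R := R) in
  let J := ideal_add
    (ideal_gen [set ('X_j : {mpoly k[n]}) ^+ i j | j in [set: 'I_n]]) I in
  is_local_ring R ->
  is_quotient_map m_R pi ->
  p \in [pchar k] ->
  (1 <= r)%N ->
  q = (p ^ r)%N ->
  (exists x : R, p%:R * x != 0) ->
  (forall x : R, m_R x -> p%:R * x = 0) ->
  (forall x : R, ideal_pow m_R e.+1 x -> x = 0) ->
  (1 <= e <= q - 1)%N ->
  (forall j, (0 < i j <= q)%N) ->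
  is_ideal I ->
  I f0 ->
  (forall l : 'X_{1..n}, l \in msupp f0 ->
     (e + 1 <= \sum_(j < n) (q * l j) %/ i j)%N) ->
  is_quotient_map J proj ->
  liftable pi (proj \o @mpolyC n k) ->
  J (w_ p (f0 ^+ (p ^ (r - 1)))).
Proof.
move=> m_R J idm quot pk r_gt0 -> [x0 px0] pm0 me0 /andP[_ le_eq] _ idI If0.
move=> floorP [proj_onto proj0] lift.
have [pi_onto pi0] := quot.
have idX := ideal_gen_ideal [set ('X_j : {mpoly k[n]}) ^+ i j | j in [set: 'I_n]].
have [I0 _ _] := idI; have [X0 _ _] := idX.
(* If A0 is the zero ring, its spectrum is empty and says nothing, but then J is
   the unit ideal. *)
apply/proj0; have [A0eq0|A1] := pselect ((1 : A0) = 0).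
  by rewrite -[LHS]mulr1 A0eq0 mulr0.
have projX j : proj ('X_j ^+ i j) = 0.
  apply/proj0; exists ('X_j ^+ i j); first by apply: mem_ideal_gen; exists j.
  by exists 0 => //; rewrite addr0.
have kA a : exists c, nilradical (a - (proj \o @mpolyC n k) c).
  have [f <-] := proj_onto a; exists f@_0%MM; rewrite /= -rmorphB.
  apply: (@ideal_of_vars _ _ (proj @^-1` @nilradical A0)).
  - exact/ideal_preim/nilradical_ideal.
  - by move=> j; exists (i j); rewrite -rmorphXn.
  - by rewrite mcoeffB mcoeffC eqxx mulr1 subrr.
have [B [sigma [psi [flat psi_sigma psi_onto ker_psi]]]] :=
  liftable_local A1 kA pi_onto lift.
have B1 : (1 : B) <> 0.
  by move=> /(congr1 psi); rewrite rmorph1 rmorph0.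
have [B' eqB] := nonzero_ring B1; subst B.
have psi_m b : ext_pow sigma m_R 1 b -> psi b = 0.
  apply: (ideal_gen_min (M := psi @^-1` [set 0])).
    by apply: ideal_preim; split=> [//|? ? -> ->|? ? ->]; rewrite ?addr0 ?mulr0.
  move=> _ [a ma <-] /=; rewrite psi_sigma /=.
  have -> : pi a = 0.
    apply/pi0; move: a ma; apply: ideal_gen_min => // _ [c mc <-].
    by rewrite big_ord1; apply: mc.
  by rewrite !rmorph0.
have p_neq0 : p%:R != 0 :> R by apply: contra px0 => /eqP->; rewrite mul0r.
apply: (@w_lift_eq0 R k pi p r e n i f0 A0 proj B' sigma psi) => //.
- by rewrite (leq_ltn_trans le_eq) // subn1 prednK // expn_gt0 prime_gt0 // (pcharf_prime pk).
- by move=> l lf; rewrite -addn1; apply: floorP.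
- by move=> b psi0; apply: (tensor_residue pi_onto pi0); left; apply: ker_psi.
- move=> b pb; apply: psi_m.
  by apply: (flat_annihilator quot flat p_neq0 pm0); rewrite rmorph_nat.
- by apply/proj0; exists 0 => //; exists f0 => //; rewrite add0r.
Qed.
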